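(* Let $(R,\mathfrak m)$ be a Cohen-Macaulay local ring of dimension one with infinite residue field and let $I_1,\ldots,I_s$ be $\mathfrak m$-primary ideals of $R$. Let $\mathcal F=\{\mathcal F(\underline n)\}_{\underline n\in\mathbb Z^s}$ be an $\underline I$-admissible filtration of ideals in $R$ and let $\mathcal A=\{a_i\in I_i: i=1,\ldots,s\}$ be a complete reduction of $\mathcal F$. Then $$\mathcal P(\mathcal F)\subseteq\mathbb N^s\quad\text{and}\quad \mathcal P(\mathcal F)=\mathcal R_{\mathcal A}(\mathcal F).$$ Moreover, the set $\mathcal R_{\mathcal A}(\mathcal F)$ is independent of the choice of the complete reduction $\mathcal A$ of $\mathcal F$.
   Context: Notation: $\mathbb N=\{0,1,2,\ldots\}$, $\lambda$ denotes length over $R$, $s\ge1$, $e=(1,\ldots,1)\in\mathbb Z^s$; $\underline n\ge\underline m$ means componentwise inequality; $\underline n^+=(\max(n_1,0),\ldots,\max(n_s,0))$; $\underline I=(I_1,\ldots,I_s)$ and $\underline I^{\underline n}=I_1^{n_1}\cdots I_s^{n_s}$, where a nonpositive power of an ideal is $R$. ''For all large $\underline n$'' means for all $\underline n\in\mathbb N^s$ with every $n_i\gg0$. Filtrations: a $\mathbb Z^s$-graded $\underline I$-filtration is a family of ideals $\mathcal F=\{\mathcal F(\underline n)\}_{\underline n\in\mathbb Z^s}$ of $R$ with $\underline I^{\underline n}\subseteq\mathcal F(\underline n)$, $\mathcal F(\underline n)\mathcal F(\underline m)\subseteq\mathcal F(\underline n+\underline m)$, and $\mathcal F(\underline m)\subseteq\mathcal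 F(\underline n)$ whenever $\underline m\geq\underline n$. It is $\underline I$-admissible if moreover $\mathcal F(\underline n)=\mathcal F(\underline n^+)$ for all $\underline n$ and $\bigoplus_{\underline n\in\mathbb Z^s}\mathcal F(\underline n)\underline t^{\underline n}$ is a finite module over $\bigoplus_{\underline n\in\mathbb Z^s}\underline I^{\underline n}\underline t^{\underline n}$, where $t_1,\dots,t_s$ are indeterminates and $\underline t^{\underline n}=t_1^{n_1}\cdots t_s^{n_s}$. $H_{\mathcal F}(\underline n)=\lambda(R/\mathcal F(\underline n))$, and $P_{\mathcal F}$ is the unique polynomial with $P_{\mathcal F}(\underline n)=H_{\mathcal F}(\underline n)$ for all large $\underline n$. A vector $\underline n\in\mathbb Z^s$ is a postulation vector of $\mathcal F$ if $H_{\mathcal F}(\underline m)=P_{\mathcal F}(\underline m)$ for all $\underline m\ge\underline n$ (in $\mathbb Z^s$); $\mathcal P(\mathcal F)\subseteq\mathbb Z^s$ is the set of postulation vectors. In dimension one, a set $\mathcal A=\{a_i\in I_i:i=1,\dots,s\}$ is a complete reduction of $\mathcal F$ if $J=(a_1\cdots a_s)$ satisfies $J\mathcal F(\underline n)=\mathcal F(\underline n+e)$ for all large $\underline n\in\mathbb N^s$. A vector $\underline r\in\mathbb N^s$ is a reduction vector of $\mathcal F$ with respect to $\mathcal A$ if $J\mathcal F(\underline n)=\mathcal F(\underline n+e)$ for all $\underline n\ge\underline r$; $\mathcal R_{\mathcal A}(\mathcal F)$ is the set of all reduction vectors of $\mathcal F$ with respect to $\mathcal A$. *)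

(* Defs.v *)
From HB Require Import structures.
From mathcomp Require Import all_boot all_order all_algebra.
From mathcomp Require Import boolp classical_sets functions cardinality fsbigop.
From mathcomp Require Import constructive_ereal.
(* The notations of mpoly clash with those of the classical layer. *)
From mathcomp Require Import -(notations) mpoly.

Set Implicit Arguments.
Unset Strict Implicit.
Unset Printing Implicit Defensive.

Import Order.TTheory GRing.Theory Num.Theory.

Local Open Scope classical_set_scope.
Local Open Scope ring_scope.

Definition is_max (C : set nat) (k : nat) : Prop :=
  C k /\ forall j, C j -> (j <= k)%N.

(* The supremum of a nonempty set of natural numbers, +oo if unbounded. *)
Definition sup_nat (C : set nat) : \bar rat :=
  xget +oo%E [set l | exists2 k, is_max C k & l = k%:R%:E].

Definition strict_chain (T : Type) (P : set (set T)) (k : nat) : Prop :=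
  exists p : nat -> set T,
    (forall i, (i <= k)%N -> P (p i)) /\
    (forall i, (i < k)%N -> p i `<` p i.+1).

Section Ideals.
Variable R : comNzRingType.
Implicit Types (I J m : set R) (xs : seq R).

(* The unit ideal setT is allowed, unlike in ring_quotient. *)
Definition is_ideal I : Prop :=
  [/\ I 0, (forall x y, I x -> I y -> I (x + y))
    & forall r x, I x -> I (r * x)].

Definition ideal_gen (S : set R) : set R := smallest is_ideal S.

Definition ideal_mul I J : set R :=
  ideal_gen [set x * y | x in I & y in J].

Definition ideal_pow I (z : int) : set R :=
  if z is Posz k then iter k (ideal_mul I) setT else setT.

Definition is_prime I : Prop :=
  [/\ is_ideal I, ~ I 1 & forall x y, I (x * y) -> I x \/ I y].

Definition is_maximal I : Prop :=
  [/\ is_ideal I, ~ I 1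
    & forall J, is_ideal J -> ~ J 1 -> I `<=` J -> J = I].

Definition radical I : set R := [set x | exists k : nat, I (x ^+ k)].

Definition is_primary I : Prop :=
  [/\ is_ideal I, ~ I 1
    & forall x y, I (x * y) -> I x \/ exists k : nat, I (y ^+ k)].

Definition m_primary m I : Prop := is_primary I /\ radical I = m.

Definition noetherian : Prop :=
  forall I, is_ideal I -> exists xs, I = ideal_gen [set` xs].

Definition local_ring m : Prop :=
  is_maximal m /\ forall m', is_maximal m' -> m' = m.

Definition krull_dim : \bar rat := sup_nat (strict_chain is_prime).

Definition regular_seq m xs : Prop :=
  [/\ forall x, x \in xs -> m x,
      forall i, (i < size xs)%N -> forall y,
        ideal_gen [set` take i xs] (xs`_i * y) -> ideal_gen [set` take i xs] y
    & ~ ideal_gen [set` xs] 1].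

Definition depth m : \bar rat :=
  sup_nat [set k | exists2 xs, regular_seq m xs & size xs = k].

Definition cohen_macaulay_local m : Prop :=
  [/\ noetherian, local_ring m & depth m = krull_dim].

(* R/m as the set of cosets of m. *)
Definition residue_field m : set (set R) :=
  range (fun x : R => [set y | m (y - x)]).

(* Length of the R-module R/I; its submodules are represented by their
   preimages in R, i.e. by the ideals containing I. *)
Definition length_quotient I : \bar rat :=
  sup_nat (strict_chain [set J | is_ideal J /\ I `<=` J]).

End Ideals.

Section Multigraded.
Variables (R : comNzRingType) (s : nat).
Local Notation Zs := {ffun 'I_s -> int}.
Implicit Types (n k r : Zs) (I : 'I_s -> set R) (F G : Zs -> set R).
Implicit Types (a : 'I_s -> R).

Definition le_vec n k : Prop := forall i, n i <= k i.

Definition Ns : set Zs := [set n | forall i, 0 <= n i].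

Definition e_vec : Zs := [ffun=> 1].

Definition pos_part n : Zs := [ffun i => Num.max (n i) 0].

Definition for_all_large (Q : Zs -> Prop) : Prop :=
  exists N : nat, forall n, (forall i, N%:Z <= n i) -> Q n.

Definition ideal_powv I n : set R :=
  \big[@ideal_mul R/setT]_(i < s) ideal_pow (I i) (n i).

(* The Laurent polynomial f = \sum_n f(n) t^n is represented by its
   coefficient function; the product is convolution. *)
Definition laurent_mul (f g : Zs -> R) : Zs -> R :=
  fun n => \sum_(k \in [set: Zs]) (f k * g (n - k)).

(* \bigoplus_n F(n) t^n *)
Definition graded_sum F : set (Zs -> R) :=
  [set f | finite_set [set n | f n != 0] /\ forall n, F n (f n)].

Definition finite_module_over (A M : set (Zs -> R)) : Prop :=
  exists (d : nat) (g : 'I_d -> Zs -> R), (forall j, M (g j)) /\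
    forall f, M f -> exists2 c : 'I_d -> Zs -> R, (forall j, A (c j)) &
      forall n, f n = \sum_(j < d) laurent_mul (c j) (g j) n.

Definition filtration I F : Prop :=
  [/\ forall n, is_ideal (F n),
      forall n, ideal_powv I n `<=` F n,
      forall n k, ideal_mul (F n) (F k) `<=` F (n + k)
    & forall n k, le_vec n k -> F k `<=` F n].

Definition admissible_filtration I F : Prop :=
  [/\ filtration I F, forall n, F n = F (pos_part n)
    & finite_module_over (graded_sum (ideal_powv I)) (graded_sum F)].

Definition hilbert_fun F n : \bar rat := length_quotient (F n).

Definition mpoly_at (P : mpoly s rat) n : rat :=
  meval (fun i => (n i)%:~R) P.

Definition is_hilbert_poly F (P : mpoly s rat) : Prop :=
  for_all_large (fun n => hilbert_fun F n = (mpoly_at P n)%:E).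

(* The default value 0 is irrelevant for admissible filtrations of m-primary
   ideals, for which a unique such polynomial exists. *)
Definition hilbert_poly F : mpoly s rat :=
  xget 0 (is_hilbert_poly F).

Definition postulation_vectors F : set Zs :=
  [set n | forall k, le_vec n k ->
             hilbert_fun F k = (mpoly_at (hilbert_poly F) k)%:E].

Definition prod_ideal a : set R := ideal_gen [set \prod_(i < s) a i].

Definition complete_reduction I F a : Prop :=
  (forall i, I i (a i)) /\
  for_all_large (fun n => ideal_mul (prod_ideal a) (F n) = F (n + e_vec)).

Definition reduction_vectors F a : set Zs :=
  [set r | Ns r /\ forall n, le_vec r n ->
             ideal_mul (prod_ideal a) (F n) = F (n + e_vec)].

End Multigraded.

Arguments krull_dim : clear implicits.
Arguments Ns : clear implicits.

(* Main.v *)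
Require Import Defs.
From mathcomp Require Import all_boot all_order all_algebra.
From mathcomp Require Import boolp classical_sets cardinality constructive_ereal.
From mathcomp Require Import ring zify.
From mathcomp Require Import -(notations) mpoly.

(** Write H(n) for the length of R/F(n), x for a_1 ... a_s, e_i for the i-th
unit vector and e for their sum.

Length is governed by one inequality: for an ideal K and an element u,
the length of R/K is at most that of R/(K : u) plus that of R/(K + (u))
([len_le_colon_adjoin]). With Noetherian induction it gives finite length
for every ideal that contains a power of each element of the maximal ideal
([cofinite_has_len]), hence for all F(n). When u is a nonzerodivisor it gives
len(R/uK) = len(R/K) + len(R/u) ([has_len_scale]).

Since x F(n) = F(n + e) for large n, the ideal (x) contains some F(k), hence a
power of a regular element of the maximal ideal; so x and its factors a_i
are nonzerodivisors. Consequently H(n + e) <= H(n) + len(R/x) for every n,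
with equality exactly when x F(n) = F(n + e).

The Hilbert polynomial can be written down. If x F(n) = F(n + e), then
cancelling the product of the a_j with j <> i yields
a_i F(n) = F(n + e_i) ([scale_unit_step]). So, for large n, a step in the
direction e_i adds l_i = len(R/a_i) > 0 to H, whence
P(n) = c + l_1 n_1 + ... + l_s n_s, and len(R/x) = l_1 + ... + l_s because
both are the increment of P along e ([hilbert_poly_complete_reduction]).

Thus P(n + e) = P(n) + len(R/x) for all integral n. If n is a postulation
vector, H has the same increments above n, so x F(k) = F(k + e) for k >= n.
Conversely, if these equalities hold above n then H - P is constant along
every ray k + te with k >= n, and it vanishes far out. A postulation vector has
no negative coordinate: F does not change when the i-th coordinate passes from
-1 to 0, whereas P grows by l_i > 0. The set of postulation vectors does not
mention a, so neither does the set of reduction vectors depend on it. *)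

Set Implicit Arguments.
Unset Strict Implicit.
Unset Printing Implicit Defensive.

Import Order.TTheory GRing.Theory Num.Theory.

Local Open Scope classical_set_scope.
Local Open Scope ring_scope.

(** * Maxima of sets of natural numbers, and chains of sets *)

Lemma is_max_uniq (C : set nat) j k : is_max C j -> is_max C k -> j = k.
Proof.
move=> [Cj jmax] [Ck kmax].
by apply/eqP; rewrite eqn_leq kmax // jmax.
Qed.

Lemma sup_natE (C : set nat) k : is_max C k -> sup_nat C = k%:R%:E.
Proof.
move=> Ck; rewrite /sup_nat; case: xgetP => [_ _ [j Cj ->]|/(_ k%:R%:E)].
  by rewrite (is_max_uniq Cj Ck).
by case; exists k.
Qed.

Lemma sup_nat_fin (C : set nat) k : sup_nat C = k%:R%:E -> is_max C k.
Proof.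
rewrite /sup_nat; case: xgetP => [_ _ [j Cj ->]|//].
by move=> [] /eqP; rewrite eqr_nat => /eqP <-.
Qed.

Lemma bounded_is_max (C : set nat) N :
  C 0%N -> (forall k, C k -> (k <= N)%N) -> exists k, is_max C k.
Proof.
move=> C0 bC.
have exC : exists k, `[< C k >] by exists 0%N; apply/asboolP.
have bC' k : `[< C k >] -> (k <= N)%N by move/asboolP/bC.
case: (ex_maxnP exC bC') => k /asboolP Ck kmax.
by exists k; split=> // j /asboolP/kmax.
Qed.

Lemma proper_subset_trans (T : Type) (A B C : set T) :
  A `<` B -> B `<=` C -> A `<` C.
Proof.
move=> [AB nBA] BC; split; first exact: subset_trans BC.
by move=> CA; apply: nBA; apply: subset_trans CA.
Qed.

(** Recording the last term [X] of a chain is what makes it possible to extend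
it step by step in [chain_to_split]. *)
Definition chain_to (T : Type) (P : set (set T)) k (X : set T) : Prop :=
  exists p : nat -> set T,
    [/\ forall i, (i <= k)%N -> P (p i),
        forall i, (i < k)%N -> p i `<` p i.+1 & p k = X].

Lemma chain_to_strict (T : Type) (P : set (set T)) k X :
  chain_to P k X -> strict_chain P k.
Proof. by move=> [p [pP pS _]]; exists p. Qed.

Lemma chain_to_extend (T : Type) (P : set (set T)) k X Y :
  chain_to P k X -> P Y -> X `<` Y -> chain_to P k.+1 Y.
Proof.
move=> [p [pP pS pk]] PY XY.
exists (fun i => if (i <= k)%N then p i else Y); split => [i _|i|] /=.
- by case: ifP => // /pP.
- rewrite ltnS => ik; rewrite ik; case: ltnP => [/pS //|ki].
  have -> : i = k by apply/eqP; rewrite eqn_leq ik.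
  by rewrite pk.
- by rewrite ltnn.
Qed.

Lemma chain_to_grow (T : Type) (P : set (set T)) k X Y :
  chain_to P k X -> P Y -> X `<=` Y ->
  exists j, [/\ chain_to P j Y, (k <= j)%N & ~ Y `<=` X -> (k < j)%N].
Proof.
move=> kX PY XY; case: (pselect (Y `<=` X)) => YX.
  have <- : X = Y by apply/seteqP.
  by exists k; split=> // -[].
by exists k.+1; split=> //; apply: (chain_to_extend kX).
Qed.

(** Two weakly increasing sequences that never pause simultaneously: dropping
the repetitions from each leaves strict chains whose lengths add up to at least
the number of steps. This replaces the refinement argument in the
Jordan-Hoelder theory. *)
Lemma chain_to_split (T : Type) (P Q : set (set T)) (A B : nat -> set T) k :
    (forall i, (i <= k)%N -> P (A i) /\ Q (B i)) ->
    (forall i, (i < k)%N -> [/\ A i `<=` A i.+1, B i `<=` B i.+1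
      & ~ (A i.+1 `<=` A i /\ B i.+1 `<=` B i)]) ->
  exists c d, [/\ chain_to P c (A k), chain_to Q d (B k) & (k <= c + d)%N].
Proof.
elim: k => [PQ _|k IH PQ st].
  have [PA QB] := PQ 0%N isT.
  exists 0%N, 0%N; split=> //.
    by exists (fun=> A 0%N); split.
  by exists (fun=> B 0%N); split.
have [i ik|i ik|c [d [cA dB kcd]]] := IH.
- by apply: PQ; apply: leqW.
- by apply: st; apply: leqW.
have [PA QB] := PQ k.+1 (leqnn _).
have [sA sB nAB] := st k (ltnSn _).
have [c' [cA' cc' lc]] := chain_to_grow cA PA sA.
have [d' [dB' dd' ld]] := chain_to_grow dB QB sB.
exists c', d'; split=> //.
case: (pselect (A k.+1 `<=` A k)) => AA; last first.
  by have := lc AA; lia.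
have /ld : ~ B k.+1 `<=` B k by move=> BB; apply: nAB.
by lia.
Qed.

(** * Length of quotients *)

Section Length.
Variable R : comNzRingType.
Implicit Types (K L : set R) (u x y z : R).

Definition over K : set (set R) := [set J | is_ideal J /\ K `<=` J].

Definition len_le K N := forall k, strict_chain (over K) k -> (k <= N)%N.

Definition has_len K k := is_max (strict_chain (over K)) k.

Lemma length_quotientE K k : has_len K k -> length_quotient K = k%:R%:E.
Proof. exact: sup_natE. Qed.

Lemma has_len_uniq K j k : has_len K j -> has_len K k -> j = k.
Proof. exact: is_max_uniq. Qed.

Lemma len_le_has_len K N : is_ideal K -> len_le K N -> exists k, has_len K k.
Proof.
move=> iK; apply: bounded_is_max.
by exists (fun=> K); split=> // i _; split.
Qed.

Lemma has_len_proper K L j k : is_ideal K -> K `<` L ->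
  has_len K j -> has_len L k -> (k < j)%N.
Proof.
move=> iK KL [_ jmax] [[p [pP pS]] _]; apply: jmax.
exists (fun i => if i is i'.+1 then p i' else K); split=> [[|i]|[|i]] //=.
- by move=> _; split.
- by rewrite ltnS => /pP [ip Lp]; split=> //; apply: subset_trans Lp; apply: properW.
- by move=> _; apply: proper_subset_trans KL _; have [] := pP 0%N isT.
- by rewrite ltnS => /pS.
Qed.

Lemma is_ideal0 K : is_ideal K -> K 0. Proof. by case. Qed.

Lemma is_idealD K x y : is_ideal K -> K x -> K y -> K (x + y).
Proof. by case=> _ + _; apply. Qed.

Lemma is_idealM K x y : is_ideal K -> K y -> K (x * y).
Proof. by case=> _ _; apply. Qed.

Lemma is_idealN K x : is_ideal K -> K x -> K (- x).
Proof. by move=> iK Kx; rewrite -mulN1r; apply: is_idealM. Qed.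

Lemma is_idealB K x y : is_ideal K -> K x -> K y -> K (x - y).
Proof. by move=> iK Kx Ky; apply: is_idealD => //; apply: is_idealN. Qed.

Lemma is_idealT : is_ideal [set: R]. Proof. by []. Qed.

Lemma is_ideal_total K : is_ideal K -> K 1 -> K = setT.
Proof.
move=> iK K1; apply/seteqP; split=> // x _.
by rewrite -[x]mulr1; apply: is_idealM.
Qed.

Lemma ideal_gen_sub (S : set R) L : is_ideal L -> S `<=` L -> ideal_gen S `<=` L.
Proof. by move=> iL SL; apply: smallest_sub. Qed.

Lemma sub_ideal_gen (S : set R) : S `<=` ideal_gen S.
Proof. exact: sub_smallest. Qed.

Lemma is_ideal_gen (S : set R) : is_ideal (ideal_gen S).
Proof.
split.
- by move=> L [iL _]; apply: is_ideal0.
- by move=> x y Sx Sy L LS; apply: is_idealD; [case: LS|apply: Sx|apply: Sy].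
- by move=> r x Sx L LS; apply: is_idealM; [case: LS|apply: Sx].
Qed.

Definition colon K u : set R := [set r | K (u * r)].

Definition adjoin K u : set R := [set z | exists r, K (z - u * r)].

Definition scale u K : set R := [set u * r | r in K].

Lemma is_ideal_colon K u : is_ideal K -> is_ideal (colon K u).
Proof.
move=> iK; split; rewrite /colon /=.
- by rewrite mulr0; apply: is_ideal0.
- by move=> x y Kx Ky; rewrite mulrDr; apply: is_idealD.
- by move=> r x Kx; rewrite mulrCA; apply: is_idealM.
Qed.

Lemma is_ideal_adjoin K u : is_ideal K -> is_ideal (adjoin K u).
Proof.
move=> iK; split; rewrite /adjoin /=.
- by exists 0; rewrite mulr0 subr0; apply: is_ideal0.
- move=> x y [r Kx] [t Ky]; exists (r + t).
  by rewrite mulrDr opprD addrACA; apply: is_idealD.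
- move=> r x [t Kx]; exists (r * t).
  by rewrite mulrCA -mulrBr; apply: is_idealM.
Qed.

Lemma is_ideal_scale K u : is_ideal K -> is_ideal (scale u K).
Proof.
move=> iK; split.
- by exists 0; rewrite ?mulr0 //; apply: is_ideal0.
- move=> _ _ [x Kx <-] [y Ky <-]; exists (x + y); rewrite ?mulrDr //.
  exact: is_idealD.
- move=> r _ [x Kx <-]; exists (r * x); first exact: is_idealM.
  by rewrite mulrCA.
Qed.

Lemma sub_adjoin K u : K `<=` adjoin K u.
Proof. by move=> x Kx; exists 0; rewrite mulr0 subr0. Qed.

Lemma mem_adjoin K u : is_ideal K -> adjoin K u u.
Proof. by move=> iK; exists 1; rewrite mulr1 subrr; apply: is_ideal0. Qed.

(** For a chain of ideals C_i above K, the chains (C_i : u) and C_i + (u)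
cannot pause at the same step: an element z of C_{i+1} is then congruent to
some ur modulo C_i, so ur lies in C_{i+1}, r in (C_{i+1} : u) = (C_i : u), and
z in C_i. This is the length inequality coming from the exact sequence
0 -> R/(K : u) -> R/K -> R/(K + (u)) -> 0. *)
Lemma len_le_colon_adjoin K u p q :
  len_le (colon K u) p -> len_le (adjoin K u) q -> len_le K (p + q).
Proof.
move=> lp lq k [C [CK Cs]].
have [i ik|i ik|c [d [/chain_to_strict/lp cp /chain_to_strict/lq dq kcd]]] :=
  @chain_to_split R (over (colon K u)) (over (adjoin K u))
    (fun i => colon (C i) u) (fun i => adjoin (C i) u) k.
- have [iC KC] := CK i ik; split; split.
  + exact: is_ideal_colon.
  + by move=> r; apply: KC.
  + exact: is_ideal_adjoin.
  + by move=> z [r] /KC; exists r.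
- have [CC nCC] := Cs i ik; split.
  + by move=> r /CC.
  + by move=> z [r] /CC; exists r.
  have [iC _] := CK i (ltnW ik).
  have [iC' _] := CK i.+1 ik.
  move=> [cC aC]; apply: nCC => z Cz.
  have [r Czr] := aC z (@sub_adjoin _ u _ Cz).
  have /cC Cr : colon (C i.+1) u r.
    rewrite /colon /= -(subKr z (u * r)).
    by apply: is_idealB => //; apply: CC.
  by rewrite -(subrK (u * r) z); apply: is_idealD.
- by rewrite (leq_trans kcd) // leq_add.
Qed.

Definition nzd u := forall y, u * y = 0 -> y = 0.

Lemma nzdI u : nzd u -> injective ( *%R u).
Proof.
move=> nu x y /= /eqP; rewrite -subr_eq0 -mulrBr => /eqP/nu/eqP.
by rewrite subr_eq0 => /eqP.
Qed.

(** The upper bound is [len_le_colon_adjoin], because (uK : u) = K and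
uK + (u) = (u). For the lower bound, u times a chain above K is followed by a
chain above (u). *)
Lemma has_len_scale K u p q : nzd u -> is_ideal K ->
  has_len K p -> has_len (scale u setT) q -> has_len (scale u K) (p + q).
Proof.
move=> nu iK [[A [AK As]] pmax] [[B [BU Bs]] qmax]; split; last first.
  apply: (@len_le_colon_adjoin _ u).
    suff -> : colon (scale u K) u = K by [].
    apply/seteqP; split=> [x [y Ky /(nzdI nu) <-//]|x Kx].
    by exists x.
  suff -> : adjoin (scale u K) u = scale u setT by [].
  apply/seteqP; split=> x [y].
    by move=> [z _ /eqP]; rewrite eq_sym subr_eq -mulrDr => /eqP ->; exists (z + y).
  move=> _ <-; exists y; exists 0; first exact: is_ideal0.
  by rewrite mulr0 subrr.
(* The top term u A_p of the first chain lies in (u), so B_0 may replace it. *)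
exists (fun i => if (i < p)%N then scale u (A i) else B (i - p)%N); split.
  move=> i ipq; case: ifP => ip.
    have [iA KA] := AK i (ltnW ip); split; first exact: is_ideal_scale.
    by move=> _ [x Kx <-]; exists x => //; apply: KA.
  have [|iB UB] := BU (i - p)%N; first by lia.
  by split=> //; apply: subset_trans UB => _ [x _ <-]; exists x.
move=> i ipq; case: (ltnP i p) => ip; last first.
  rewrite ltnNge (leqW ip) /= subSn //; apply: Bs; move: ip ipq; lia.
have sA : scale u (A i) `<` scale u (A i.+1).
  have [AA nAA] := As i ip; split=> [_ [x Ax <-]|sAA].
    by exists x => //; apply: AA.
  apply: nAA => x Ax; have [|y Ay /(nzdI nu) <- //] := sAA (u * x).
  by exists x.
case: ltnP => // pi; apply: proper_subset_trans sA _.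
have [|_ UB] := BU (i.+1 - p)%N; first by lia.
by apply: subset_trans UB => _ [x _ <-]; exists x.
Qed.

(** Were [Q] to fail at some ideal, dependent choice would give a strictly
increasing sequence of counterexamples, whose union is finitely generated and
so equals one of its terms. *)
Lemma noetherian_ind (Q : set R -> Prop) : noetherian R ->
    (forall K, is_ideal K ->
      (forall L, is_ideal L -> K `<` L -> Q L) -> Q K) ->
  forall K, is_ideal K -> Q K.
Proof.
move=> noeth step K0 iK0; apply: contrapT => nQ0.
pose bad K := is_ideal K /\ ~ Q K.
have /choice [f fP] : forall K, exists L, bad K -> bad L /\ K `<` L.
  move=> K; case: (pselect (bad K)) => [[iK nQ]|nb]; last by exists K.
  apply: contrapT => nL; apply/nQ/step => // L iL KL.
  by apply: contrapT => nQL; apply: nL; exists L.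
pose C n := iter n f K0.
have badC n : bad (C n) by elim: n => [|n /fP []].
have CS n : C n `<` C n.+1 by have [] := fP _ (badC n).
have Cle n k : (n <= k)%N -> C n `<=` C k.
  move=> /subnK <-; elim: (k - n)%N => // j IH.
  by rewrite addSn; apply: (subset_trans IH); apply: properW; apply: CS.
pose U := \bigcup_n C n.
have iU : is_ideal U.
  split.
  - by exists 0%N => //; apply: is_ideal0.
  - move=> x y [i _ Cx] [j _ Cy]; exists (maxn i j) => //.
    apply: is_idealD; first by case: (badC (maxn i j)).
      by apply: Cle Cx; rewrite leq_maxl.
    by apply: Cle Cy; rewrite leq_maxr.
  - move=> r x [i _ Cx]; exists i => //; apply: is_idealM => //.
    by case: (badC i).
have [xs Uxs] := noeth U iU.
have [N CN] : exists N, [set` xs] `<=` C N.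
  have : [set` xs] `<=` U by rewrite Uxs; apply: sub_ideal_gen.
  elim: xs {Uxs} => [_|x xs IH sU]; first by exists 0%N.
  have [y xsy|N CN] := IH; first by apply: sU; rewrite /= inE xsy orbT.
  have [M _ CM] : U x by apply: sU; rewrite /= mem_head.
  exists (maxn M N) => y /=; rewrite inE => /orP[/eqP ->|/CN Cy].
    by apply: Cle CM; rewrite leq_maxl.
  by apply: Cle Cy; rewrite leq_maxr.
have [_] := CS N; apply; apply: (@subset_trans _ U).
  by move=> x Cx; exists N.+1.
by rewrite Uxs; apply: ideal_gen_sub => //; case: (badC N).
Qed.

(** When m is maximal and K is proper, this says that the radical of K is m. *)
Definition cofinite (m : set R) K := forall z, m z -> exists k, K (z ^+ k).

(** Such a [K] is m itself: by primality it contains m, which is maximal. *)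
Lemma len_le_prime m K : is_maximal m -> is_ideal K -> ~ K 1 ->
  (forall u v, K (u * v) -> K u \/ K v) -> cofinite m K -> len_le K 1.
Proof.
move=> [_ _ mmax] iK nK1 prK mK.
have KE : K = m.
  apply: mmax => // z /mK [k]; elim: k => [//|k IH].
  by rewrite exprS => /prK [//|/IH].
move=> [|[|k]] // [C [CK Cs]].
have [iC1 KC1] := CK 1%N isT.
have [_ nC10] := Cs 0%N isT.
have [_ nC21] := Cs 1%N isT.
have [_ KC0] := CK 0%N isT.
case: (pselect (C 1%N 1)) => [C1|nC1].
  by exfalso; apply: nC21; rewrite (is_ideal_total iC1 C1).
exfalso; apply: nC10; rewrite (mmax _ iC1 nC1) -?KE //.
Qed.

(** By Noetherian induction: unless K is prime or the unit ideal, there are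
u, v outside K with uv in K, and then (K : u) and K + (u) are both strictly
larger than K. *)
Lemma cofinite_has_len m K : noetherian R -> is_maximal m ->
  is_ideal K -> cofinite m K -> exists k, has_len K k.
Proof.
move=> noeth mmax iK cK.
suff [N KN] : exists N, len_le K N by apply: len_le_has_len KN.
move: K iK cK.
apply: (@noetherian_ind (fun K => cofinite m K -> exists N, len_le K N)) => //.
move=> K iK IH cK.
have cL L : K `<=` L -> cofinite m L.
  by move=> KL z /cK [k Kz]; exists k; apply: KL.
case: (pselect (K 1)) => [K1|nK1].
  exists 0%N => -[//|k [C [CK Cs]]].
  have [_ KC] := CK 0%N isT; have [_ []] := Cs 0%N isT.
  by apply: subset_trans KC; rewrite (is_ideal_total iK K1).
case: (pselect (forall u v, K (u * v) -> K u \/ K v)) => [prK|].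
  by exists 1%N; apply: (len_le_prime mmax).
move=> /existsNP [u] /existsNP [v] /not_implyP [Kuv /not_orP [nKu nKv]].
have KcK : K `<` colon K u.
  split=> [x Kx|sub]; first exact: is_idealM.
  by apply: nKv; apply: sub.
have KaK : K `<` adjoin K u.
  split=> [|sub]; first exact: sub_adjoin.
  by apply: nKu; apply: sub; apply: mem_adjoin.
have [|p lp] := IH _ (is_ideal_colon u iK) KcK; first exact: (cL _ (properW KcK)).
have [|q lq] := IH _ (is_ideal_adjoin u iK) KaK; first exact: (cL _ (properW KaK)).
by exists (p + q)%N; apply: len_le_colon_adjoin lp lq.
Qed.

End Length.

(** * Products and powers of ideals, nonzerodivisors *)

Section Products.
Variables (R : comNzRingType) (s : nat).
Implicit Types (x y : R) (K L : set R) (n : {ffun 'I_s -> int}).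
Implicit Types (I : 'I_s -> set R) (a u : 'I_s -> R).

Lemma mem_ideal_mul K L x y : K x -> L y -> ideal_mul K L (x * y).
Proof. by move=> Kx Ly; apply: sub_ideal_gen; exists x => //; exists y. Qed.

Lemma mem_ideal_pow K x (z : int) : K x -> ideal_pow K z (x ^+ `|z|).
Proof.
case: z => [k|k] Kx //=.
by elim: k => [|k IH] //; rewrite exprS /=; apply: mem_ideal_mul.
Qed.

Lemma mem_ideal_powv I n u : (forall i, ideal_pow (I i) (n i) (u i)) ->
  ideal_powv I n (\prod_i u i).
Proof.
move=> Iu; rewrite /ideal_powv.
apply: (big_ind2 (fun x (K : set R) => K x)) => // x1 K1 x2 K2.
exact: mem_ideal_mul.
Qed.

Lemma principalE x : ideal_gen [set x] = scale x setT.
Proof.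
apply/seteqP; split.
  apply: ideal_gen_sub; first exact/is_ideal_scale/is_idealT.
  by move=> _ ->; exists 1; rewrite ?mulr1.
move=> _ [y _ <-]; rewrite mulrC; apply: (is_idealM _ (is_ideal_gen _)).
exact: sub_ideal_gen.
Qed.

Lemma principal_mulE x L : is_ideal L -> ideal_mul (ideal_gen [set x]) L = scale x L.
Proof.
move=> iL; apply/seteqP; split; last first.
  by move=> _ [y Ly <-]; apply: mem_ideal_mul => //; apply: sub_ideal_gen.
apply: ideal_gen_sub; first exact: is_ideal_scale.
move=> _ [z + [y Ly <-]]; rewrite principalE => -[r _ <-].
by exists (r * y); [exact: is_idealM|rewrite mulrA].
Qed.

Lemma nzd_mul (x y z : R) : nzd x -> x = y * z -> nzd z.
Proof. by move=> nx xyz t zt; apply: nx; rewrite xyz -mulrA zt mulr0. Qed.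

Lemma nzd_exp (x : R) k : nzd x -> nzd (x ^+ k).
Proof.
move=> nx y; elim: k => [|k IH]; first by rewrite expr0 mul1r.
by rewrite exprS -mulrA => /nx.
Qed.

(** The depth is 1, so there is a regular sequence of length one; its only
term is regular modulo the ideal generated by the empty set, which is zero. *)
Lemma cm1_nzd (m : set R) : cohen_macaulay_local m -> krull_dim R = 1%:E ->
  exists2 y, m y & nzd y.
Proof.
move=> [_ _ <-] d1; have [[[//|y []//] [ym reg _] _] _] := @sup_nat_fin _ 1%N d1.
exists y; first by apply: ym; rewrite mem_head.
move=> z yz; have := reg 0%N isT z; rewrite /= yz.
have gen0 : ideal_gen [set` [::] : seq R] `<=` [set 0].
  apply: ideal_gen_sub; last by [].
  split=> [//|_ _ -> ->|r _ ->]; by rewrite /= ?addr0 ?mulr0.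
by move=> /(_ (is_ideal0 (is_ideal_gen _)))/gen0.
Qed.

End Products.

(** * Polynomials determined by their values at large vectors *)

Section Polynomials.
Variable s : nat.
Implicit Types (P Q : mpoly s rat) (n : {ffun 'I_s -> int}).

(** Restriction to a diagonal line reduces questions about several variables
to the fact that a univariate polynomial has finitely many roots. *)
Lemma mpoly_at_line P n :
  exists q : {poly rat}, forall t : nat,
    q.[t%:R] = mpoly_at P (n + [ffun=> t%:Z]).
Proof.
exists (\sum_(m <- msupp P)
  (mcoeff m P)%:P * \prod_i (((n i)%:~R)%:P + 'X) ^+ m i) => t.
rewrite /mpoly_at mevalE horner_sum; apply: eq_bigr => m _.
rewrite hornerM hornerC horner_prod; congr (_ * _); apply: eq_bigr => i _.
by rewrite horner_exp hornerD hornerC hornerX !ffunE intrD.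
Qed.

Lemma poly_eq_large (p q : {poly rat}) N :
  (forall t, (N <= t)%N -> p.[t%:R] = q.[t%:R]) -> p = q.
Proof.
move=> pq; apply/eqP; rewrite -subr_eq0; apply/negPn/negP => nz.
have := @max_poly_roots _ (p - q) [seq (i%:R : rat) | i <- iota N (size (p - q)).+1] nz.
rewrite size_map size_iota ltnNge leqnSn => H.
have : false; last by [].
apply: H.
  apply/allP => _ /mapP [t + ->]; rewrite mem_iota => /andP[Nt _].
  by rewrite /root hornerD hornerN pq // subrr.
rewrite map_inj_uniq ?iota_uniq // => i j /eqP; rewrite eqr_nat => /eqP //.
Qed.

Lemma mpoly_at_eq P Q :
  for_all_large (fun n => mpoly_at P n = mpoly_at Q n) ->
  forall n, mpoly_at P n = mpoly_at Q n.
Proof.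
move=> [N PQ] n.
have [p pP] := mpoly_at_line P n; have [q qQ] := mpoly_at_line Q n.
have <- : n + [ffun=> 0%N%:Z] = n by apply/ffunP => i; rewrite !ffunE addr0.
rewrite -pP -qQ; congr (_.[_]).
apply: (@poly_eq_large _ _ (N + \sum_i `|n i|)%N) => t Nt; rewrite pP qQ.
apply: PQ => i; rewrite !ffunE.
have : (`|n i| <= \sum_i `|n i|)%N by rewrite (bigD1 i) //= leq_addr.
move: (n i) Nt; case=> j; rewrite ?NegzE /=; lia.
Qed.

Definition linear_mpoly (c : rat) (l : 'I_s -> rat) : mpoly s rat :=
  mpolyC s c + \sum_i mpolyC s (l i) * mpolyX rat (mnm1 i).

Lemma linear_mpolyE c l n :
  mpoly_at (linear_mpoly c l) n = c + \sum_i l i * (n i)%:~R.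
Proof.
rewrite /mpoly_at /linear_mpoly mevalD mevalC raddf_sum; congr (_ + _).
apply: eq_bigr => i _ /=; rewrite mevalM mevalC mevalXU //.
Qed.

Lemma hilbert_polyE (R : comNzRingType) (F : {ffun 'I_s -> int} -> set R) P :
  is_hilbert_poly F P ->
  forall n, mpoly_at (hilbert_poly F) n = mpoly_at P n.
Proof.
move=> FP; apply: mpoly_at_eq.
have : is_hilbert_poly F (hilbert_poly F).
  by rewrite /hilbert_poly; case: xgetP => [_ _ //|/(_ P)].
move: FP => [N FP] [M FQ]; exists (maxn N M) => n ln.
suff : (mpoly_at (hilbert_poly F) n)%:E = (mpoly_at P n)%:E by case.
by rewrite -FQ ?FP // => i; apply: le_trans (ln i); rewrite lez_nat;
  [apply: leq_maxl|apply: leq_maxr].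
Qed.

End Polynomials.

(** * Unit vectors of the exponent lattice *)

Section UnitVectors.
Variable s : nat.
Implicit Types (n k : {ffun 'I_s -> int}).

Lemma le_vec_trans n1 n2 n3 : le_vec n1 n2 -> le_vec n2 n3 -> le_vec n1 n3.
Proof. by move=> l12 l23 i; apply: le_trans (l12 i) (l23 i). Qed.

Lemma le_vecDr n k : Ns s k -> le_vec n (n + k).
Proof. by move=> k0 i; rewrite ffunE lerDl k0. Qed.

Lemma Ns_e_vec : Ns s (e_vec s).
Proof. by move=> i; rewrite ffunE. Qed.

Definition unit_vec (i : 'I_s) : {ffun 'I_s -> int} := [ffun j => (j == i)%:Z].

Lemma Ns_unit_vec i : Ns s (unit_vec i).
Proof. by move=> j; rewrite ffunE. Qed.

Definition const_vec (N : nat) : {ffun 'I_s -> int} := [ffun=> N%:Z].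

Lemma sum_vecD (l : 'I_s -> rat) n k :
  \sum_j l j * ((n + k) j)%:~R = \sum_j l j * (n j)%:~R + \sum_j l j * (k j)%:~R.
Proof.
by rewrite -big_split; apply: eq_bigr => j _; rewrite ffunE intrD mulrDr.
Qed.

Lemma sum_e_vec (l : 'I_s -> rat) : \sum_j l j * (e_vec s j)%:~R = \sum_j l j.
Proof. by apply: eq_bigr => j _; rewrite ffunE mulr1. Qed.

Lemma sum_unit_vec (l : 'I_s -> rat) i : \sum_j l j * (unit_vec i j)%:~R = l i.
Proof.
rewrite (bigD1 i) //= ffunE eqxx mulr1 big1 ?addr0 // => j ji.
by rewrite ffunE (negPf ji) mulr0.
Qed.

Lemma const_of_unit_steps (T : Type) (g : {ffun 'I_s -> int} -> T) (N : nat) :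
    (forall n i, le_vec (const_vec N) n -> g (n + unit_vec i) = g n) ->
  forall n, le_vec (const_vec N) n -> g n = g (const_vec N).
Proof.
move=> gstep n Nn.
have gmuln i (j : nat) n' : le_vec (const_vec N) n' ->
    le_vec (const_vec N) (n' + unit_vec i *+ j) /\ g (n' + unit_vec i *+ j) = g n'.
  move=> Nn'; elim: j => [|j [IH1 IH2]]; first by rewrite mulr0n addr0.
  rewrite mulrSr addrA gstep //; split=> //.
  exact: le_vec_trans IH1 (le_vecDr _ (Ns_unit_vec i)).
have gsum (v : 'I_s -> nat) (r : seq 'I_s) n' : le_vec (const_vec N) n' ->
    g (n' + \sum_(i <- r) unit_vec i *+ v i) = g n'.
  elim: r n' => [|i r IH] n' Nn'; first by rewrite big_nil addr0.
  have [Nn'' gn'] := gmuln i (v i) n' Nn'.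
  by rewrite big_cons addrA IH.
rewrite -[RHS](gsum (fun i => `|(n i - N%:Z)%R|%N) (index_enum _)) //.
congr g; apply/ffunP => j; rewrite !ffunE sum_ffunE (bigD1 j) //= big1.
  rewrite ffunMnE ffunE eqxx addr0.
  by have := Nn j; rewrite ffunE; move: (n j); lia.
by move=> i ij; rewrite ffunMnE ffunE eq_sym (negPf ij) mul0rn.
Qed.

End UnitVectors.

(** * Filtrations and complete reductions *)

Section Filtrations.
Variables (R : comNzRingType) (m : set R) (s : nat).
Variables (I : 'I_s -> set R) (F : {ffun 'I_s -> int} -> set R).
Hypotheses (noeth : noetherian R) (mmax : is_maximal m).
Hypotheses (mI : forall i, m_primary m (I i)) (filF : filtration I F).
Implicit Types (n : {ffun 'I_s -> int}) (a u : 'I_s -> R).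

Lemma filtration_ideal n : is_ideal (F n).
Proof. by case: filF. Qed.

Lemma filtration_mul n (k : {ffun _ -> _}) u z : (forall i, ideal_pow (I i) (k i) (u i)) ->
  F n z -> F (n + k) ((\prod_i u i) * z).
Proof.
case: filF => _ IF FF _ Iu Fz; rewrite addrC; apply: FF.
apply: mem_ideal_mul => //; apply: IF; exact: mem_ideal_powv.
Qed.

Lemma filtration_mul1 n a z i : I i (a i) -> F n z ->
  F (n + unit_vec i) (a i * z).
Proof.
move=> Ia Fz; have -> : a i = \prod_j (if j == i then a j else 1).
  by rewrite -big_mkcond big_pred1_eq.
apply: filtration_mul => // j; rewrite ffunE; case: eqP => [->|] //=.
by have := mem_ideal_pow 1 Ia.
Qed.

(** If z^(k_i) lies in I_i then z^(k_1 n_1 + ... + k_s n_s) lies in I^n. *)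
Lemma filtration_cofinite n : cofinite m (F n).
Proof.
move=> z mz.
have /choice [k Ik] : forall i, exists k, I i (z ^+ k).
  by move=> i; have [_ rI] := mI i; move: mz; rewrite -rI.
exists (\sum_i k i * `|n i|)%N; rewrite -prodrXr.
case: filF => _ IF _ _; apply: IF; apply: mem_ideal_powv => i.
by rewrite exprM; apply: mem_ideal_pow.
Qed.

Lemma filtration_has_len : exists h : {ffun 'I_s -> int} -> nat,
  forall n, has_len (F n) (h n).
Proof.
suff /choice [h hF] : forall n, exists k, has_len (F n) k by exists h.
move=> n; apply: (cofinite_has_len noeth mmax) => //.
  exact: filtration_ideal.
exact: filtration_cofinite.
Qed.

Section CompleteReduction.
Variable a : 'I_s -> R.
Hypotheses (ha : complete_reduction I F a).
Hypothesis (mnzd : exists2 y, m y & nzd y).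

Local Notation x := (\prod_i a i).

Lemma complete_reduction_scale n :
  ideal_mul (prod_ideal a) (F n) = scale x (F n).
Proof. exact/principal_mulE/filtration_ideal. Qed.

Lemma scale_sub n : scale x (F n) `<=` F (n + e_vec s).
Proof.
case: ha => Ia _ _ [z Fz <-]; apply: filtration_mul => // i.
by rewrite ffunE; have := mem_ideal_pow 1 (Ia i).
Qed.

(** The ideal (x) contains x F(k) = F(k + e) for k large. *)
Lemma cofinite_prod : cofinite m (scale x setT).
Proof.
case: ha => _ [N xF] z /(@filtration_cofinite (const_vec s N + e_vec s)) [k].
rewrite -xF => [|i]; last by rewrite ffunE.
by rewrite complete_reduction_scale => -[y _ xy]; exists k; exists y.
Qed.

(** A power of a regular element of m is a multiple of x. *)
Lemma nzd_prod : nzd x.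
Proof.
have [y /cofinite_prod [k [t _ xt]] /(@nzd_exp _ _ k) nyk] := mnzd.
by apply: (nzd_mul nyk (y := t)); rewrite mulrC.
Qed.

Lemma nzd_factor i : nzd (a i).
Proof. by apply: (nzd_mul nzd_prod); rewrite (bigD1 i) //= mulrC. Qed.

Lemma nzd_cofactor i : nzd (\prod_(j | j != i) a j).
Proof. by apply: (nzd_mul nzd_prod); rewrite (bigD1 i). Qed.

(** For z in F(n + e_i), the product of z with all a_j, j <> i, lies in
F(n + e) = x F(n); cancelling these factors shows that z is in a_i F(n). *)
Lemma scale_unit_step i n : scale x (F n) = F (n + e_vec s) ->
  scale (a i) (F n) = F (n + unit_vec i).
Proof.
case: ha => Ia _ xF; apply/seteqP; split=> [_ [z Fz <-]|z Fz].
  exact: filtration_mul1.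
have : F (n + e_vec s) ((\prod_(j | j != i) a j) * z).
  have -> : n + e_vec s = n + unit_vec i + (e_vec s - unit_vec i).
    by rewrite -addrA [unit_vec i + _]addrC subrK.
  rewrite [\prod_(j | _) _]big_mkcond; apply: filtration_mul => // j.
  rewrite !ffunE; case: eqP => //= _.
  by have := mem_ideal_pow 1 (Ia j).
rewrite -xF => -[t Ft]; rewrite (bigD1 i) //= [a i * _]mulrC -mulrA.
by move=> /(nzdI (@nzd_cofactor i)) <-; exists t.
Qed.

(** The length is positive because a_i lies in the proper ideal I_i. *)
Lemma factor_len : exists l : 'I_s -> nat,
  forall i, (0 < l i)%N /\ has_len (scale (a i) setT) (l i).
Proof.
suff /choice [l hl] : forall i, exists k, (0 < k)%N /\ has_len (scale (a i) setT) k.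
  by exists l.
move=> i.
have [ai iT] := (@is_ideal_scale _ setT (a i) (@is_idealT R), @is_idealT R).
have [|l hl] := cofinite_has_len noeth mmax ai.
  move=> z /cofinite_prod [k [t _ xt]]; exists k; rewrite -xt.
  exists ((\prod_(j | j != i) a j) * t) => //.
  by rewrite mulrA [RHS](congr1 (fun y => y * t) (bigD1 i _)).
exists l; split=> //.
have [k hk] : exists k, has_len [set: R] k.
  by apply: (cofinite_has_len noeth mmax iT) => z _; exists 0%N.
apply: leq_ltn_trans (leq0n k) (has_len_proper ai _ hl hk).
split=> // sub; have [//|t _ at1] := sub 1.
have [[[_ nI1 _] _] [Ia _]] := (mI i, ha).
by apply: nI1; rewrite -at1 mulrC; apply: is_idealM => //; case: (mI i) => -[].
Qed.

(** The function g(n) = H(n) - sum_i l_i n_i does not change under large unit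
steps, so it is eventually a constant c. The length of R/x is then read off from
H(n + e) - H(n) at one large n. *)
Lemma hilbert_poly_complete_reduction : exists (c : rat) (l : 'I_s -> nat),
  [/\ forall i, (0 < l i)%N,
      has_len (scale x setT) (\sum_i l i)
    & is_hilbert_poly F (linear_mpoly c (fun i => (l i)%:R))].
Proof.
have [h hF] := filtration_has_len.
have [l hl] := factor_len.
have [_ [N xF]] := ha.
have {}xF n : le_vec (const_vec s N) n -> scale x (F n) = F (n + e_vec s).
  move=> Nn; rewrite -complete_reduction_scale xF // => i.
  by have := Nn i; rewrite ffunE.
pose g n : rat := (h n)%:R - \sum_i (l i)%:R * (n i)%:~R.
have gstep n i : le_vec (const_vec s N) n -> g (n + unit_vec i) = g n.
  move=> Nn; rewrite /g.
  have -> : h (n + unit_vec i) = (l i + h n)%N.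
    apply: has_len_uniq (hF _) _; rewrite -(scale_unit_step i (xF n Nn)) addnC.
    apply: has_len_scale => //; [exact: nzd_factor|exact: filtration_ideal|].
    by case: (hl i).
  by rewrite sum_vecD (sum_unit_vec (fun i => (l i)%:R)) natrD; ring.
have hE n : le_vec (const_vec s N) n ->
    (h n)%:R = g (const_vec s N) + \sum_i (l i)%:R * (n i)%:~R.
  by move=> Nn; rewrite -(const_of_unit_steps gstep Nn) /g subrK.
exists (g (const_vec s N)), l; split.
- by move=> i; case: (hl i).
- have [q hq] : exists q, has_len (scale x setT) q.
    apply: (cofinite_has_len noeth mmax); last exact: cofinite_prod.
    exact/is_ideal_scale/is_idealT.
  have Nle : le_vec (const_vec s N) (const_vec s N) by move=> i.
  have Nle' : le_vec (const_vec s N) (const_vec s N + e_vec s).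
    exact: le_vecDr (@Ns_e_vec s).
  suff <- : q = (\sum_i l i)%N by [].
  have := has_len_scale nzd_prod (filtration_ideal (const_vec s N)) (hF _) hq.
  rewrite xF // => /(has_len_uniq (hF _)) hNe.
  have := hE _ Nle'; rewrite hNe natrD hE // -addrA => /addrI.
  rewrite sum_vecD (sum_e_vec (fun i => (l i)%:R)) => /addrI/eqP.
  by rewrite -natr_sum eqr_nat => /eqP.
- exists N => n Nn; rewrite linear_mpolyE /hilbert_fun (length_quotientE (hF n)).
  by congr (_%:E); apply: hE => i; rewrite ffunE.
Qed.

End CompleteReduction.

(** Here P is affine with P(n + e_i) = P(n) + l_i on the whole lattice, which
turns both inclusions into comparisons of increments of H and P along e. *)
Lemma postulation_eq_reduction a :
    (exists2 y, m y & nzd y) -> complete_reduction I F a ->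
    (forall n, F n = F (pos_part n)) ->
  postulation_vectors F `<=` Ns s /\ postulation_vectors F = reduction_vectors F a.
Proof.
move=> mnzd ha Fpos.
have [h hF] := filtration_has_len.
have [c [l [lpos hx hP]]] := hilbert_poly_complete_reduction ha mnzd.
pose P n : rat := c + \sum_i (l i)%:R * (n i)%:~R.
have hPE n : mpoly_at (hilbert_poly F) n = P n.
  by rewrite (hilbert_polyE hP) linear_mpolyE.
have postE n : (hilbert_fun F n = (mpoly_at (hilbert_poly F) n)%:E) <-> (h n)%:R = P n.
  rewrite hPE /hilbert_fun (length_quotientE (hF n)).
  by split=> [[]//|->].
have [N hN] : for_all_large (fun n => (h n)%:R = P n).
  by have [N hN] := hP; exists N => n /hN; rewrite -(hilbert_polyE hP) => /postE.
have Punit n i : P (n + unit_vec i) = P n + (l i)%:R.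
  by rewrite /P sum_vecD (sum_unit_vec (fun i => (l i)%:R)) addrA.
have Pe n : P (n + e_vec s) = P n + (\sum_i l i)%:R.
  by rewrite /P sum_vecD (sum_e_vec (fun i => (l i)%:R)) natr_sum addrA.
have scaleE n : scale (\prod_i a i) (F n) = F (n + e_vec s) <->
    h (n + e_vec s) = (h n + \sum_i l i)%N.
  have hs := has_len_scale (nzd_prod ha mnzd) (filtration_ideal n) (hF n) hx.
  split=> [E|E]; first by apply: has_len_uniq (hF _) _; rewrite -E.
  apply/seteqP; split; first exact: scale_sub.
  apply: contrapT => nsub.
  have := has_len_proper (is_ideal_scale _ (filtration_ideal n))
            (conj (scale_sub ha (n := n)) nsub) hs (hF _).
  by rewrite E ltnn.
have post_nonneg : postulation_vectors F `<=` Ns s.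
  move=> n post i; rewrite leNgt; apply/negP => ni.
  (* Crossing from k_i = -1 to k_i = 0 leaves pos_part k, hence F, unchanged. *)
  pose k := [ffun j => if j == i then -1 else n j] : {ffun 'I_s -> int}.
  have nk : le_vec n k.
    by move=> j; rewrite ffunE; case: eqP => // ->; move: ni; lia.
  have nk' : le_vec n (k + unit_vec i).
    exact: le_vec_trans nk (le_vecDr _ (Ns_unit_vec i)).
  have hk : h (k + unit_vec i) = h k.
    apply: has_len_uniq (hF _) _; rewrite Fpos.
    suff -> : pos_part (k + unit_vec i) = pos_part k by rewrite -Fpos.
    by apply/ffunP => j; rewrite !ffunE; case: eqP => // _; rewrite addr0.
  have := (postE _).1 (post _ nk'); rewrite hk (postE _).1 ?Punit //; last exact: post.
  move=> /eqP; rewrite -subr_eq0 opprD addrA subrr sub0r oppr_eq0 pnatr_eq0.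
  by have := lpos i; case: (l i).
split=> //; apply/seteqP; split=> r.
  move=> post; split; first exact: post_nonneg.
  move=> n rn; rewrite complete_reduction_scale scaleE.
  apply/eqP; rewrite -(eqr_nat rat) natrD.
  have re : le_vec r (n + e_vec s).
    exact: le_vec_trans rn (le_vecDr _ (@Ns_e_vec s)).
  by rewrite (postE _).1 ?(postE n).1 ?Pe //; apply: post.
move=> [_ red] n rn; apply/postE.
have hstep t : (h (n + e_vec s *+ t))%:R - P (n + e_vec s *+ t) = (h n)%:R - P n.
  elim: t => [|t IH]; first by rewrite mulr0n addr0.
  rewrite mulrSr addrA Pe.
  have /scaleE -> : scale (\prod_i a i) (F (n + e_vec s *+ t))
      = F (n + e_vec s *+ t + e_vec s).
    rewrite -complete_reduction_scale red //.
    apply: (le_vec_trans rn); apply: le_vecDr => i.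
    by rewrite ffunMnE ffunE mulrn_wge0.
  by rewrite natrD -IH; ring.
(* A translation by this multiple of e takes n above (N, ..., N). *)
apply/eqP; rewrite -subr_eq0 -(hstep (N + \sum_i `|n i|)%N) subr_eq0; apply/eqP/hN.
move=> i; rewrite ffunE ffunMnE ffunE.
have : (`|n i| <= \sum_i `|n i|)%N by rewrite (bigD1 i) //= leq_addr.
move: (\sum_i _)%N => S; rewrite natz; move: (n i) => [j|j]; rewrite ?NegzE /=; lia.
Qed.

End Filtrations.

Theorem theorem1p12 (R : comNzRingType) (m : set R) (s : nat)
    (I : 'I_s -> set R) (F : {ffun 'I_s -> int} -> set R) (a : 'I_s -> R)
    (hCM : cohen_macaulay_local m) (hdim : krull_dim R = 1%:E)
    (hres : infinite_set (residue_field m))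
    (hs : (1 <= s)%N)
    (hI : forall i, m_primary m (I i))
    (hF : admissible_filtration I F)
    (ha : complete_reduction I F a) :
  [/\ postulation_vectors F `<=` Ns s,
      postulation_vectors F = reduction_vectors F a
    & forall b : 'I_s -> R, complete_reduction I F b ->
        reduction_vectors F b = reduction_vectors F a].
Proof.
have mnzd := cm1_nzd hCM hdim.
have [noeth [mmax _] _] := hCM.
have [filF Fpos _] := hF.
have main b hb := postulation_eq_reduction noeth mmax hI filF (a := b) mnzd hb Fpos.
have [postN postE] := main a ha.
by split=> // b /main [_ <-].
Qed.
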